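(* For every integer $n\geq 3$, $$s(\mathbb{M}^n_Z)\geq\binom{n+1}{\lfloor (n+1)/2\rfloor}.$$ Therefore $s(\mathbb{M}^n_Z)=\Theta(2^n/\sqrt{n})$ (as $n\to\infty$).
   Context: A Minkowski space $\mathbb{M}^n$ is an $n$-dimensional real normed space $(\mathbb{R}^n,\|\cdot\|)$. A Steiner tree of a finite set $N\subset\mathbb{M}^n$ is a finite tree $T$ whose vertex set $V(T)$ is a finite set of points of $\mathbb{M}^n$ with $N\subseteq V(T)$; its length is $\ell(T)=\sum_{xy\in E(T)}\|x-y\|$. The points of $N$ are called nodes or given points, the points of $V(T)\setminus N$ are called Steiner points. A Steiner minimal tree (SMT) of $N$ is a Steiner tree of $N$ of minimum length. $s(\mathbb{M}^n)$ denotes the maximum degree of a Steiner point in an SMT, the maximum being taken over all SMTs (of all finite sets $N$) in $\mathbb{M}^n$. $\mathbb{M}^n_Z$ denotes $\mathbb{R}^n$ with the norm whose unit ball is $\operatorname{conv}([0,1]^n\cup[-1,0]^n)$. *)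

(* Defs.v *)
From HB Require Import structures.
From mathcomp Require Import all_boot all_order all_algebra finmap.
From mathcomp Require Import all_classical all_reals interval_inference.
From mathcomp Require Import topology normedtype convex landau.

Set Implicit Arguments.
Unset Strict Implicit.
Unset Printing Implicit Defensive.

Import Order.TTheory GRing.Theory Num.Theory.
Import numFieldNormedType.Exports.

Local Open Scope classical_set_scope.
Local Open Scope ring_scope.

(* Trees are nonempty. [ucycle e c] also holds for a one-edge walk
   [:: x; y] back and forth, whence [size c <= 2]. *)
Definition is_tree (T : finType) (e : rel T) : Prop :=
  [/\ (0 < #|T|)%N, symmetric e, irreflexive e,
      forall x y, connect e x y
    & forall c : seq T, ucycle e c -> (size c <= 2)%N].

Record point_graph (V : choiceType) := PointGraph {
  vertices : {fset V};
  adj : rel vertices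
}.

Definition steiner_tree (V : choiceType) (N : {fset V}) (T : point_graph V) :
  Prop := (N `<=` vertices T)%fset /\ is_tree (@adj V T).

(* Each edge is counted once in each direction, whence the factor 1/2. *)
Definition tree_length (R : realType) (V : normedModType R)
    (T : point_graph V) : R :=
  2^-1 * \sum_(x : vertices T) \sum_(y : vertices T | adj x y)
           `|val x - val y|.

Definition steiner_minimal_tree (R : realType) (V : normedModType R)
    (N : {fset V}) (T : point_graph V) : Prop :=
  steiner_tree N T /\
  forall T' : point_graph V, steiner_tree N T' ->
    tree_length T <= tree_length T'.

Definition degree (V : choiceType) (T : point_graph V) (v : vertices T) : nat :=
  #|[set w | adj v w]%SET|.

Definition steiner_point_degrees (R : realType) (V : normedModType R) :
    set nat :=
  [set d | exists (N : {fset V}) (T : point_graph V) (v : vertices T),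
     [/\ steiner_minimal_tree N T, val v \notin N & degree v = d]].

(* The maximum of [steiner_point_degrees V]; the value is 0 if there is no
   maximum, so a positive lower bound on it entails that the maximum exists. *)
Definition max_steiner_degree (R : realType) (V : normedModType R) : nat :=
  xget 0%N [set m | steiner_point_degrees V m /\
                    forall d, steiner_point_degrees V d -> (d <= m)%N].

Definition convex_hull (R : realType) (V : lmodType R) (A : set V) : set V :=
  smallest (@convex_set R V) A.

(* Minkowski functional of B. *)
Definition gauge_of (R : realType) (V : lmodType R) (B : set V) (x : V) : R :=
  inf [set r : R | 0 < r /\ B (r^-1 *: x)].

Definition Zball (R : realType) (n : nat) : set 'rV[R]_n :=
  convex_hull ([set x : 'rV[R]_n | forall i, 0 <= x ord0 i <= 1] `|`
               [set x : 'rV[R]_n | forall i, -1 <= x ord0 i <= 0]).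

(* A copy of R^n, to carry a norm other than the library's sup norm. *)
Definition MZ (R : realType) (n : nat) : Type := 'rV[R]_n.

HB.instance Definition _ (R : realType) (n : nat) :=
  GRing.Lmodule.copy (MZ R n) 'rV[R]_n.

Section Znorm.
Context {R : realType} {n : nat}.
Implicit Types x y : 'rV[R]_n.

(* The largest positive part of a coordinate; the norm is hi x + hi (- x). *)
Definition hi x : R := \big[Num.max/0]_(i < n) x ord0 i.

Lemma hi_ge0 x : 0 <= hi x.
Proof. exact: bigmax_ge_id. Qed.

Lemma le_hi x i : x ord0 i <= hi x.
Proof. by apply: (le_bigmax _ (fun i => x ord0 i)). Qed.

Lemma hi_le x c : 0 <= c -> (forall i, x ord0 i <= c) -> hi x <= c.
Proof. by move=> c0 h; apply: bigmax_le. Qed.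

Lemma hiD x y : hi (x + y) <= hi x + hi y.
Proof.
apply: hi_le => [|i]; first by rewrite addr_ge0 ?hi_ge0.
by rewrite mxE lerD ?le_hi.
Qed.

Lemma hiZ (a : R) x : 0 <= a -> hi (a *: x) = a * hi x.
Proof.
have le b z : 0 <= b -> hi (b *: z) <= b * hi z.
  move=> b0; apply: hi_le => [|i]; first by rewrite mulr_ge0 ?hi_ge0.
  by rewrite mxE ler_wpM2l ?le_hi.
move=> a0; have [->|an0] := eqVneq a 0.
  rewrite scale0r mul0r; apply/eqP; rewrite eq_le hi_ge0 andbT.
  by apply: hi_le => // i; rewrite mxE.
apply/eqP; rewrite eq_le le //= -ler_pdivlMl ?lt_def ?an0 //.
by rewrite -{1}(scale1r x) -(mulVf an0) -scalerA le ?invr_ge0.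
Qed.

Lemma Zball_hiP x : Zball x <-> hi x + hi (- x) <= 1.
Proof.
split.
  move=> xB; apply: (xB [set y | hi y + hi (- y) <= 1]).
  split => [y z t|y] /=; last first.
    case=> h.
      rewrite -[1]addr0 lerD ?hi_le // => i; rewrite ?mxE.
        by case/andP: (h i).
      by rewrite oppr_le0; case/andP: (h i).
    rewrite -[1]add0r lerD ?hi_le // => i; rewrite ?mxE.
      by case/andP: (h i).
    by rewrite lerNl; case/andP: (h i).
  rewrite !inE /= => hy hz; rewrite /conv/=.
  rewrite -[X in hi X + _]/(t%:num *: y + (1 - t%:num) *: z).
  rewrite -[X in hi (- X)]/(t%:num *: y + (1 - t%:num) *: z).
  rewrite opprD -!scalerN.
  have t0 : 0 <= t%:num by [].
  have t1 : 0 <= (1 - t%:num) by rewrite subr_ge0.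
  apply: (@le_trans _ _ (t%:num * (hi y + hi (- y)) +
                         (1 - t%:num) * (hi z + hi (- z)))).
    rewrite !mulrDr -!hiZ // addrACA.
    by rewrite lerD // hiD.
  apply: (@le_trans _ _ (t%:num * 1 + (1 - t%:num) * 1)).
    by apply: lerD; apply: ler_wpM2l.
  by rewrite !mulr1 addrC subrK.
move=> h A [cA AC].
have conv2 (y z : 'rV[R]_n) (t : R) : 0 <= t -> t <= 1 ->
    A y -> A z -> A (t *: y + (1 - t) *: z).
  move=> t0 t1 Ay Az.
  have t01 : 0 <= t <= 1 by rewrite t0 t1.
  have := cA y z (Itv01 t0 t1); rewrite !inE; exact.
have A0 : A 0 by apply: AC; left => i; rewrite mxE lexx ler01.
have cut (c : R) y : 0 <= c -> (forall i, y ord0 i <= c) ->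
    exists2 u : 'rV[R]_n, forall i, 0 <= u ord0 i <= 1 &
                          c *: u = \row_i Num.max (y ord0 i) 0.
  move=> c0 yc; have [c0E|cn0] := eqVneq c 0.
    exists 0 => [i|]; first by rewrite mxE lexx ler01.
    apply/rowP => i; rewrite !mxE mulr0; apply/esym/max_idPr.
    by rewrite -c0E yc.
  exists (c^-1 *: \row_i Num.max (y ord0 i) 0); last first.
    by rewrite scalerA mulfV // scale1r.
  move=> i; rewrite !mxE mulr_ge0 ?invr_ge0 ?le_max ?lexx ?orbT //=.
  by rewrite ler_pdivrMl ?lt_def ?cn0 // mulr1 ge_max yc.
have [u u01 eu] := cut (hi x) x (hi_ge0 _) (le_hi _).
have [w w01 ew] := cut (hi (- x)) (- x) (hi_ge0 _) (le_hi _).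
have Au : A u by apply: AC; left.
have Aw : A (- w).
  by apply: AC; right => i; rewrite mxE lerNl opprK oppr_le0 andbC.
have ex : x = hi x *: u + hi (- x) *: - w.
  rewrite scalerN eu ew; apply/rowP => i; rewrite !mxE.
  case: (leP 0 (x ord0 i)) => x0.
    by rewrite max_r ?subr0 // oppr_le0.
  by rewrite max_l ?sub0r ?opprK // oppr_ge0 ltW.
have p0 := hi_ge0 x; have q0 := hi_ge0 (- x).
rewrite ex; set p := hi x in h p0 *; set q := hi (- x) in h q0 *.
have [s0|sn0] := eqVneq (p + q) 0.
  move/eqP: s0; rewrite paddr_eq0 // => /andP[/eqP -> /eqP ->].
  by rewrite !scale0r addr0.
have sp : 0 < p + q by rewrite lt_def sn0 addr_ge0.
have -> : p *: u + q *: - w =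
   (p + q) *: (p / (p + q) *: u + (1 - p / (p + q)) *: - w) +
   (1 - (p + q)) *: 0.
  rewrite scaler0 addr0 scalerDr !scalerA mulrBr mulr1 mulrCA mulfV // mulr1.
  by rewrite (addrC p q) addrK.
apply: (conv2) => //; first exact: ltW.
apply: conv2 => //; first by rewrite divr_ge0 // ltW.
by rewrite ler_pdivrMr // mul1r lerDl.
Qed.

Lemma gauge_ZballE x : gauge_of (@Zball R n) x = hi x + hi (- x).
Proof.
have c0 : 0 <= hi x + hi (- x) by rewrite addr_ge0 ?hi_ge0.
have E (r : R) : 0 < r -> Zball (r^-1 *: x) <-> hi x + hi (- x) <= r.
  move=> r0; have ri0 : 0 <= r^-1 by rewrite invr_ge0 ltW.
  rewrite Zball_hiP -scalerN !hiZ // -mulrDr.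
  by rewrite ler_pdivrMl // mulr1.
have ne : hi x + hi (- x) + 1 \in [set r : R | 0 < r /\ Zball (r^-1 *: x)].
  have r0 : 0 < hi x + hi (- x) + 1 by rewrite ltr_wpDl.
  by rewrite inE /=; split=> //; apply/E => //; rewrite lerDl.
apply/eqP; rewrite eq_le; apply/andP; split; last first.
  apply: lb_le_inf; first by eexists; exact: (set_mem ne).
  by move=> r [r0 /(E _ r0)].
apply/ler_addgt0Pr => e e0; apply: ge_inf.
  by exists 0 => r [/ltW].
have r0 : 0 < hi x + hi (- x) + e by rewrite ltr_wpDl.
by split=> //; apply/E => //; rewrite lerDl ltW.
Qed.

Lemma gauge_ZballD x y : gauge_of (@Zball R n) (x + y) <=
  gauge_of (@Zball R n) x + gauge_of (@Zball R n) y.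
Proof. by rewrite !gauge_ZballE opprD addrACA lerD ?hiD. Qed.

Lemma gauge_ZballZ (a : R) x :
  gauge_of (@Zball R n) (a *: x) = `|a| * gauge_of (@Zball R n) x.
Proof.
rewrite !gauge_ZballE; have [a0|/ltW a0] := leP 0 a.
  by rewrite ger0_norm // -scalerN !hiZ // mulrDr.
have -> : a *: x = - (- a *: x) by rewrite scaleNr opprK.
rewrite ler0_norm // opprK -scalerN !hiZ ?oppr_ge0 // -mulrDr.
by rewrite [hi x + _]addrC.
Qed.

Lemma gauge_Zball_eq0 x : gauge_of (@Zball R n) x = 0 -> x = 0.
Proof.
rewrite gauge_ZballE => /eqP; rewrite paddr_eq0 ?hi_ge0 //.
move=> /andP[/eqP h1 /eqP h2]; apply/rowP => i; rewrite mxE; apply/le_anti.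
rewrite -{1}h1 le_hi /=; have := le_hi (- x) i.
by rewrite h2 mxE oppr_le0.
Qed.

End Znorm.

HB.instance Definition _ (R : realType) (n : nat) :=
  Lmodule_isNormed.Build R (MZ R n)
    (@gauge_ZballD R n) (@gauge_ZballZ R n) (@gauge_Zball_eq0 R n).

Lemma MZ_unit_ball (R : realType) (n : nat) :
  [set x : MZ R n | `|x| <= 1] = @Zball R n.
Proof.
by apply/seteqP; split => x; rewrite Zball_hiP -gauge_ZballE.
Qed.

(* Main.v *)
(* Lower bound: in R^(n+1) modulo constants, normed by max - min, the vectors
   1_S with #|S| = (n+1)/2 have norm 1 and pairwise distance 2.  The unit balls
   around points at pairwise distance 2 do not overlap and a connected graph
   crosses each of them, so a connected graph through N such points has length
   at least N; the star centred at 0 attains this.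
   Upper bound: to each neighbour w of a vertex v of a minimal tree attach the
   set S_w of coordinates where w - v is maximal.  If S_1 <= S_2 <= S_3 for three
   neighbours, then exchanging the edges v w_i near v for a tree with two new
   Steiner points v + t 1_{S_2}/2 and v + t (1_{S_1} + 1_{S_3})/2 shortens the
   tree.  Hence the S_w have no 3-chain and, by the LYM inequality, v has degree
   at most 2 C(n+1, (n+1)/2). *)

Require Import Defs.
From HB Require Import structures.
From mathcomp Require Import all_boot all_order all_algebra finmap.
From mathcomp Require Import all_classical all_reals interval_inference.
From mathcomp Require Import topology normedtype convex landau.
From mathcomp Require Import zify ring lra.

Set Implicit Arguments.
Unset Strict Implicit.
Unset Printing Implicit Defensive.

Import Order.TTheory GRing.Theory Num.Theory.
Import numFieldNormedType.Exports.

Local Open Scope classical_set_scope.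
Local Open Scope ring_scope.

(** * Families of sets without long chains *)

(** Inclusion is not strict, so distinct indices with equal sets may occur in one chain. Chains are
    listed from the largest set down. *)
Definition chain_free (T I : finType) (S : I -> {set T}) (D : {set I})
    (k : nat) : Prop :=
  forall s : seq I, uniq s -> {subset s <= D} ->
    sorted (fun i j => S j \subset S i) s -> (size s <= k)%N.

Lemma card_setD1 (T : finType) (A : {set T}) (a : T) (m : nat) :
  #|A| = m.+1 -> a \in A -> #|A :\ a| = m.
Proof. by move=> cardA aA; move: cardA; rewrite (cardsD1 a) aA => -[]. Qed.

Lemma chain_free0 (T I : finType) (S : I -> {set T}) (D : {set I}) (i : I) :
  chain_free S D 0 -> i \in D -> False.
Proof.
move=> cf iD; suff: (size [:: i] <= 0)%N by [].
by apply: cf => // j; rewrite inE => /eqP ->.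
Qed.

Lemma chain_free_setD1 (T I : finType) (S : I -> {set T}) (D : {set I})
    (k : nat) (i : I) :
  chain_free S D k.+1 -> i \in D -> (forall j, j \in D -> S j \subset S i) ->
  chain_free S (D :\ i) k.
Proof.
move=> cf iD top s us sD ch; suff: (size (i :: s) <= k.+1)%N by [].
apply: cf => /=.
- by rewrite us andbT; apply/negP => /sD; rewrite !inE eqxx.
- by move=> j; rewrite inE => /predU1P[->//|/sD/setD1P[]].
- case: s us sD ch => //= j s _ sD ->; rewrite andbT top //.
  by have /setD1P[] := sD j (mem_head _ _).
Qed.

(* Averaging over the sets [A :\ a], which contain [S i] for all but [#|S i|]
   elements [a] of [A], reduces [#|A|]; only an index with [S i = A] has to be
   removed beforehand, and it can be put in front of every chain. *)
Lemma chain_free_LYM (R : numFieldType) (T I : finType) (S : I -> {set T})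
    (A : {set T}) (D : {set I}) (k : nat) :
  chain_free S D k -> (forall i, i \in D -> S i \subset A) ->
  \sum_(i in D) ('C(#|A|, #|S i|)%:R : R)^-1 <= k%:R.
Proof.
move: {2}#|A| (erefl #|A|) => m; elim: m k A D => [|m IHm] k A D cardA.
all: elim: k D => [|k IHk] D cfD DA; first by
  rewrite big_pred0 // => i; apply/negP => /(chain_free0 cfD).
all: have [/existsP[i /andP[iD /eqP SiA]]|] := boolP [exists i in D, S i == A];
  first by rewrite (big_setD1 i) //= SiA binn invr1 -natr1 addrC lerD2r;
    apply: IHk => [|j /setD1P[_ /DA] //]; apply: chain_free_setD1; rewrite ?SiA.
  move=> /existsPn nA; rewrite big1 // => i iD; exfalso.
  move: (nA i); rewrite iD /= => /negP; apply.
  by rewrite eqEcard DA // cardA leq0n.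
move=> /existsPn nA.
have m1 : (m.+1%:R : R) != 0 by rewrite pnatr_eq0.
rewrite -(ler_pM2l (_ : 0 < m.+1%:R)) ?ltr0n // mulr_sumr.
(* Each [i] occurs once for every [a] in [A :\: S i]. With s = |S i| the weights agree because
   (m+1-s) C(m+1, s) = (m+1) C(m, s). *)
have -> : \sum_(i in D) m.+1%:R * ('C(#|A|, #|S i|)%:R : R)^-1 =
    \sum_(a in A) \sum_(i in [set i in D | S i \subset A :\ a])
      ('C(#|A :\ a|, #|S i|)%:R : R)^-1.
  rewrite (exchange_big_dep (mem D)) /=; last first.
    by move=> a i _; rewrite inE => /andP[].
  apply: eq_bigr => i iD.
  have SA := DA i iD.
  have ltS : (#|S i| < m.+1)%N.
    rewrite -cardA; apply: proper_card; rewrite finset.properEneq SA andbT.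
    by have := nA i; rewrite iD.
  rewrite (eq_bigl (mem (A :\: S i))); last first.
    move=> a; rewrite !inE iD /= finset.subsetD1 SA /=.
    by rewrite andbC.
  rewrite (eq_bigr (fun=> ('C(m, #|S i|)%:R : R)^-1)); last first.
    by move=> a /finset.setDP[aA _]; rewrite (card_setD1 cardA aA).
  rewrite sumr_const cardsD (finset.setIidPr SA) cardA.
  have := mul_bin_down m.+1 #|S i|; rewrite /= => /(congr1 (fun x => x%:R : R)).
  rewrite !natrM => E.
  have b1 : ('C(m, #|S i|)%:R : R) != 0 by rewrite pnatr_eq0 -lt0n bin_gt0.
  have b2 : ('C(m.+1, #|S i|)%:R : R) != 0.
    by rewrite pnatr_eq0 -lt0n bin_gt0 ltnW.
  rewrite -[RHS]mulr_natl; apply: (mulIf b1); rewrite mulfVK //.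
  by apply: (mulIf b2); rewrite mulrAC mulfVK.
rewrite -cardA mulr_natl -sumr_const.
apply: ler_sum => a aA; apply: IHm => [|s us sD ch|i].
- exact: card_setD1.
- by apply: cfD => // i /sD; rewrite inE => /andP[].
- by rewrite inE => /andP[].
Qed.

(** The ratio of C(n, j+1) to C(n, j) is (n-j)/(j+1), at least 1 below the middle; symmetry covers
    the other half. *)
Lemma leq_bin_half (n k : nat) : ('C(n, k) <= 'C(n, n./2))%N.
Proof.
have up (j d : nat) : (j + d <= n./2)%N -> ('C(n, j) <= 'C(n, j + d))%N.
  elim: d => [|d IH] h; first by rewrite addn0.
  apply: leq_trans (IH _) _; first by lia.
  rewrite addnS -(leq_pmul2l (ltn0Sn (j + d))) mul_bin_left leq_mul2r.
  by apply/orP; right; lia.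
have le_half (j : nat) : (j <= n./2)%N -> ('C(n, j) <= 'C(n, n./2))%N.
  by move=> h; have := @up j (n./2 - j)%N; rewrite subnKC // leqnn; apply.
have [h|h] := leqP k n./2; first exact: le_half.
have [kn|kn] := leqP k n; last by rewrite bin_small.
by rewrite -bin_sub //; apply: le_half; lia.
Qed.

Lemma card_chain_free (T I : finType) (S : I -> {set T}) (D : {set I})
    (k : nat) :
  chain_free S D k -> (#|D| <= k * 'C(#|T|, #|T|./2))%N.
Proof.
move=> /(@chain_free_LYM rat _ _ _ [set: T]) /(_ (fun i _ => finset.subsetT _)) h.
have b0 : 0 < ('C(#|T|, #|T|./2)%:R : rat) by rewrite ltr0n bin_gt0; lia.
rewrite -(ler_nat rat) natrM -ler_pdivrMr //; apply: le_trans h.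
rewrite mulr_natl -sumr_const; apply: ler_sum => i _.
rewrite cardsT lef_pV2 ?posrE // ?ltr0n ?bin_gt0 ?max_card //.
by rewrite ler_nat leq_bin_half.
Qed.

(** * Central binomial coefficients *)

Lemma central_bin_rec (k : nat) :
  (k.+1 * 'C(k.+1.*2, k.+1) = k.*2.+1.*2 * 'C(k.*2, k))%N.
Proof.
have e1 := mul_bin_diag k.+1.*2 k.
have e2 := mul_bin_down k.*2.+1 k.
rewrite doubleS /= in e1 *.
have : ((k.*2.+1 - k) * (k.*2.+2 * 'C(k.*2.+1, k)) =
        k.*2.+2 * (k.*2.+1 * 'C(k.*2, k)))%N by rewrite e2; lia.
rewrite e1; set a := 'C(_, k.+1); set b := 'C(_, _).
have -> : (k.*2.+1 - k = k.+1)%N by lia.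
have -> : (k.*2.+2 = k.+1 * 2)%N by lia.
rewrite -!mulnA => /eqP; rewrite eqn_pmul2l // => /eqP ->; lia.
Qed.

(** Squaring keeps C(2k, k) <= 4^k / sqrt(2k+1) within the integers. The induction step comes down
    to (2k+1)(2k+3) <= 4(k+1)^2. *)
Lemma central_bin_le (k : nat) : (k.*2.+1 * 'C(k.*2, k) ^ 2 <= 16 ^ k)%N.
Proof.
elim: k => // k IH; have E := central_bin_rec k.
rewrite -(leq_pmul2l (_ : 0 < k.+1 ^ 2)%N) ?expn_gt0 //.
rewrite mulnCA -expnMn E expnMn (expnS 16).
set b := ('C(_, _) ^ 2)%N in IH *.
set q := (16 ^ k)%N in IH *.
apply: (@leq_trans (k.+1.*2.+1 * (4 * k.*2.+1) * (k.*2.+1 * b))).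
  by rewrite -muln2 -!mulnA; nia.
apply: (@leq_trans (k.+1.*2.+1 * (4 * k.*2.+1) * q)).
  by rewrite leq_mul2l IH orbT.
by rewrite [leqRHS]mulnA leq_mul2r; apply/orP; right; nia.
Qed.

(** The induction step comes down to 4(k+1)(k+2) <= (2k+3)^2. The index is shifted since the bound
    fails at 0. *)
Lemma central_bin_ge (k : nat) :
  (16 ^ k.+1 <= 4 * k.+1 * 'C(k.+1.*2, k.+1) ^ 2)%N.
Proof.
elim: k => [|k IH]; first by [].
have E := central_bin_rec k.+1.
rewrite -(leq_pmul2l (_ : 0 < k.+2 ^ 2)%N) ?expn_gt0 //.
rewrite [X in (_ <= X)%N]mulnCA -expnMn E expnMn (expnS 16).
set b := ('C(_, _) ^ 2)%N in IH *.
set q := (16 ^ k.+1)%N in IH *.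
apply: (@leq_trans (k.+2 ^ 2 * (16 * (4 * k.+1 * b)))).
  by rewrite !leq_mul2l IH !orbT.
rewrite !mulnA leq_mul2r; apply/orP; right; nia.
Qed.

Lemma half_bin_bounds (m : nat) : (0 < m)%N ->
  (m * 'C(m, m./2) ^ 2 <= 4 ^ m <= 4 * m * 'C(m, m./2) ^ 2)%N.
Proof.
have pow16 (k : nat) : (16 ^ k = 4 ^ k.*2)%N by rewrite -mul2n expnM.
rewrite -(odd_double_half m) half_bit_double; move: m./2 => k.
case: (odd m) => m0.
  rewrite add1n.
  (* An odd row is reduced to the next row, whose central coefficient is twice as large. *)
  have D : ('C(k.+1.*2, k.+1) = 2 * 'C(k.*2.+1, k))%N.
    rewrite doubleS binS -(@bin_sub k.*2.+1 k.+1); last by lia.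
    have -> : (k.*2.+1 - k.+1 = k)%N by lia.
    by rewrite addnn mul2n.
  have := central_bin_le k.+1; have := central_bin_ge k.
  rewrite D expnMn pow16 doubleS [(4 ^ _.+2)%N]expnS.
  move: ('C(_, k) ^ 2)%N (4 ^ _)%N => b q; nia.
rewrite add0n in m0 *; case: k m0 => // k _.
have := central_bin_le k.+1; have := central_bin_ge k.
rewrite pow16; move: ('C(_, k.+1) ^ 2)%N (4 ^ _)%N => b q; nia.
Qed.

Lemma half_bin_asymp (R : realType) (n : nat) : (0 < n)%N ->
  2^-1 * (2 ^+ n / Num.sqrt (n%:R : R)) <= ('C(n.+1, n.+1./2)%:R : R) <=
  2 * (2 ^+ n / Num.sqrt (n%:R : R)).
Proof.
move=> n0; have /andP[lo up] := half_bin_bounds (ltn0Sn n).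
set b := 'C(_, _) in lo up *.
have s0 : 0 < Num.sqrt (n%:R : R) by rewrite sqrtr_gt0 ltr0n.
have ss : Num.sqrt (n%:R : R) ^+ 2 = n%:R by rewrite sqr_sqrtr.
have p4 : (4%:R : R) ^+ n = (2 ^+ n) ^+ 2.
  by rewrite -exprM mulnC exprM; congr (_ ^+ n); rewrite -natrX.
(* The bounds for row n+1 are rewritten in terms of n by n <= n+1 <= 2n. *)
have lo' : (n * b ^ 2 <= 4 * 4 ^ n)%N by rewrite -expnS; nia.
have up' : (4 ^ n <= 2 * n * b ^ 2)%N by move: up; rewrite expnS; nia.
move: (Num.sqrt _) s0 ss => s s0 ss.
move: lo' up'; rewrite -!(ler_nat R) !natrM !natrX p4 -ss => lo' up'.
rewrite ler_pdivrMl // mulrA ler_pdivrMr // ler_pdivlMr //.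
have P0 : 0 <= (2 : R) ^+ n by rewrite exprn_ge0.
have b0 : 0 <= b%:R :> R by [].

have sq (x y : R) : 0 <= x -> 0 <= y -> x ^+ 2 <= y ^+ 2 -> x <= y.
  by move=> x0 y0; rewrite ler_sqr.
by apply/andP; split; apply: sq; rewrite -?mulrA ?mulr_ge0 ?(ltW s0) // !exprMn; lra.
Qed.

(** * Lengths of connected graphs *)

(** Turns any connected graph containing the nodes into a Steiner tree that is no longer. The tree
    is a symmetric connected edge set of least cardinality. *)
Lemma spanning_tree (T : finType) (e : rel T) :
  (0 < #|T|)%N -> symmetric e -> (forall x y, connect e x y) ->
  exists2 e' : rel T, subrel e' e & is_tree e'.
Proof.
move=> T0 se ce.
pose r (E : {set T * T}) : rel T := fun x y => (x, y) \in E.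
pose P E := [forall x, forall y, r E x y ==> r E y x && e x y] &&
            [forall x, forall y, connect (r E) x y].
pose E0 : {set T * T} := [set xy | e xy.1 xy.2]%SET.
have rE0 : r E0 =2 e by move=> x y; rewrite /r inE.
have PE0 : P E0.
  apply/andP; split; apply/forallP => x; apply/forallP => y.
    by rewrite !rE0 se; apply/implyP => ->.
  by rewrite (eq_connect rE0).
case: (arg_minnP (fun E : {set T * T} => #|E|) PE0) => E PE minE.
have /andP[/forallP PE1 /forallP PE2] := PE.
have sub x y : r E x y -> r E y x /\ e x y.
  by move=> rxy; have /forallP/(_ y) := PE1 x; rewrite rxy => /andP.
have sE : symmetric (r E).
  by move=> x y; apply/idP/idP => /sub[].
have cE x y : connect (r E) x y by have /forallP := PE2 x; exact.
(* By minimality no edge of E lies on a cycle. *)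
have cut (a b : T) : r E a b ->
    connect (r (E :\ (a, b) :\ (b, a))%SET) a b -> False.
  move=> rab; set E' := (_ :\ _)%SET => cab.
  have rE' x y : r E' x y =
      [&& (x, y) != (b, a), (x, y) != (a, b) & r E x y].
    by rewrite /r !inE.
  have sE' : symmetric (r E').
    move=> x y; rewrite !rE' sE !xpair_eqE.
    rewrite [(x == b) && _]andbC [(x == a) && _]andbC.
    by rewrite andbCA.
  have PE' : P E'.
    apply/andP; split; apply/forallP => x; apply/forallP => y.
      rewrite sE'; apply/implyP => rxy; rewrite rxy.
      by have := rxy; rewrite rE' => /and3P[_ _ /sub[]]; rewrite se.
    apply: (connect_sub _ (cE x y)) => {x y}x y rxy.
    have [/eqP[-> ->]|n1] := boolP ((x, y) == (a, b)); first exact: cab.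
    have [/eqP[-> ->]|n2] := boolP ((x, y) == (b, a)).
      by rewrite sym_connect_sym.
    by apply: connect1; rewrite rE' n1 n2.
  have := minE E' PE'; rewrite leqNgt => /negP; apply.
  apply: proper_card; apply/properP; split.
    by apply/fintype.subsetP => x; rewrite !inE => /and3P[].
  by exists (a, b) => //; rewrite !inE eqxx andbF.
exists (r E); first by move=> x y /sub[].
split=> // [x|c].
  by apply/negP => rxx; exact: (cut x x rxx (connect0 _ _)).
case/andP; case: c => [|x [|y [|z s]]] //= /and3P[exy eyz pz].
rewrite !inE !negb_or => /and3P[/and3P[xy xz xs] /andP[yz ys] _].
(* The edge yz and the rest of the cycle, which avoids y, still join y to x once the edge xy is
   deleted. *)
exfalso; apply: (cut y x); first by rewrite sE.
apply: (@connect_trans _ _ z).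
  apply: connect1; move: eyz; rewrite /r !inE !xpair_eqE => ->.
  by rewrite (eq_sym y x) (negPf xy) /= (eq_sym z x) (negPf xz) andbF.
apply/connectP; exists (rcons s x); last by rewrite last_rcons.
apply: (@sub_in_path _ (predC1 y) _ _ _ _ _ _ pz).
  move=> a b; rewrite !inE => /negPf ay /negPf bY; rewrite /r !inE => ->.
  by rewrite !xpair_eqE ay bY andbF.
rewrite /= all_rcons /= xy eq_sym yz /=; apply/allP => t ts /=.
by apply: contraNneq ys => <-.
Qed.

(** Every edge has exactly one end equal to [c], so a cycle of length at least 3 would visit [c]
    twice. *)
Lemma star_is_tree (T : finType) (c : T) :
  is_tree (fun x y : T => (x == c) (+) (y == c)).
Proof.
split=> [||x|x y|].
- by apply/card_gt0P; exists c.
- by move=> x y; rewrite addbC.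
- by rewrite addbb.
- apply: (@connect_trans _ _ c).
    by have [->|xc] := eqVneq x c => //; rewrite connect1 //= (negPf xc) eqxx.
  by have [->|yc] := eqVneq y c => //; rewrite connect1 //= (negPf yc) eqxx.
case=> [|x [|y [|z s]]] //; rewrite /ucycle /= => /andP[/and3P[xy yz]].
move=> pz /and4P[]; rewrite !inE !negb_or => /and3P[nxy nxz _] /andP[nyz nys].
move=> zs _; exfalso.
have yc : y == c.
  apply: contraNT nxz => yc; move: xy yz; rewrite (negPf yc) addbF => /eqP ->.
  by move=> /= /eqP ->.
have zc : (z == c) = false by apply: contraNF nyz => /eqP ->.
case: s pz nys zs => [|w s] /=; rewrite zc /=.
  by rewrite andbT => /eqP xc _ _; move: nxy; rewrite xc eq_sym yc.
by move=> /andP[/eqP -> _]; rewrite inE yc.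
Qed.

Lemma ler_sum_sub (R : numDomainType) (I : eqType) (s t : seq I) (F : I -> R) :
  uniq s -> {subset s <= t} -> (forall i, 0 <= F i) ->
  \sum_(i <- s) F i <= \sum_(i <- t) F i.
Proof.
move=> + + F0; elim: s t => [|x s IH] t /=; first by rewrite big_nil sumr_ge0.
move=> /andP[xs us] st; have xt : x \in t by apply: st; rewrite mem_head.
rewrite big_cons (big_rem x xt) /= lerD2l IH // => y ys.
have yx : y != x by apply: contraNneq xs => <-.
have : y \in t by apply: st; rewrite inE ys orbT.
by rewrite (perm_mem (perm_to_rem xt)) inE (negPf yx).
Qed.

(** The positive drops of [f] along a path from [a] to [b] add up to at least [f a - f b]; the
    factor 2 comes from counting each edge in both directions. *)
Lemma connect_flow (R : realDomainType) (T : finType) (e : rel T)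
    (f : T -> R) (a b : T) :
  symmetric e -> connect e a b ->
  2 * (f a - f b) <= \sum_x \sum_(y | e x y) `|f x - f y|.
Proof.
move=> se /connectP[p0 ep0]; case/shortenP: ep0 => p ep up _ ->.
pose P (x y : T) := Num.max 0 (f x - f y).
have P0 x y : 0 <= P x y by rewrite le_max lexx.
have -> : \sum_x \sum_(y | e x y) `|f x - f y| =
          2 * \sum_x \sum_(y | e x y) P x y.
  rewrite mulrDl mul1r [X in _ = _ + X](exchange_big_dep predT) //= -big_split /=.
  apply: eq_bigr => x _.
  rewrite [X in _ = _ + X](eq_bigl (e x)); last by move=> y; rewrite se.
  rewrite -big_split; apply: eq_bigr => y _ /=; rewrite /P -[f y - f x]opprB.
  case: (leP 0 (f x - f y)) => h.
    by rewrite ger0_norm // max_l ?addr0 // oppr_le0.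
  by rewrite ltr0_norm // max_r ?add0r // oppr_ge0 ltW.
rewrite ler_pM2l ?ltr0n //.
(* The path is simple, so each of its vertices [x] occurs once, and the edge leaving [x] is one of
   the terms for [x]. *)
suff h : f a - f (last a p) <= \sum_(x <- a :: p) \sum_(y | e x y) P x y.
  apply: le_trans h _; apply: ler_sum_sub => // x; exact: sumr_ge0.
elim: p a ep {up} => [|y p IH] a /=.
  by rewrite subrr big_cons addr_ge0 ?big_nil // sumr_ge0.
move=> /andP[eay /IH h]; rewrite big_cons -(subrK (f y) (f a)) -addrA lerD //.
rewrite (bigD1 y) //= -[leLHS]addr0 lerD ?sumr_ge0 //.
by rewrite le_max lexx orbT.
Qed.

(** * Tent functions and the packing bound for trees *)

Definition tent (R : realType) (V : normedModType R) (p x : V) : R :=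
  Num.max 0 (1 - `|x - p|).

Section Packing.
Context {R : realType} {V : normedModType R}.
Implicit Types p q x y : V.

Lemma tent_ge0 p x : 0 <= tent p x. Proof. by rewrite le_max lexx. Qed.

Lemma tent_lipschitz p x y : `|tent p x - tent p y| <= `|x - y|.
Proof.
have h : `| `|x - p| - `|y - p| | <= `|x - y|.
  by apply: le_trans (ler_dist_dist _ _) _; rewrite opprB addrA subrK.
move: h; rewrite ler_norml => /andP[h1 h2].
rewrite /tent ler_norml; have := normr_ge0 (x - y).
case: (leP 0 (1 - `|x - p|)); case: (leP 0 (1 - `|y - p|)); lra.
Qed.

Lemma tent_disjoint p q x : 2 <= `|p - q| -> 0 < tent p x -> tent q x = 0.
Proof.
move=> pq; rewrite /tent lt_max ltxx /= => h; apply/max_idPl.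
have := ler_distD x p q; rewrite (distrC p x); lra.
Qed.

Lemma tentD p q x y : 2 <= `|p - q| -> 0 < tent p x -> 0 < tent q y ->
  tent p x + tent q y <= `|x - y|.
Proof.
move=> pq; rewrite /tent !lt_max !ltxx /= => h1 h2.
rewrite !max_r ?(ltW h1) ?(ltW h2) //.
have := ler_distD x p q; have := ler_distD y x q; rewrite (distrC p x); lra.
Qed.

(** Tents of two nodes are never positive at the same point, so at most two terms are nonzero. One
    tent is 1-Lipschitz; for two tents [tentD] applies. *)
Lemma sum_tent_le (N : {fset V}) x y :
  {in N &, forall p q, p != q -> 2 <= `|p - q|} ->
  \sum_(p : N) `|tent (val p) x - tent (val p) y| <= `|x - y|.
Proof.
move=> Nd; have {}Nd (p q : N) : q != p -> 2 <= `|val p - val q|.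
  by move=> pq; apply: Nd; rewrite ?(valP p) ?(valP q) // eq_sym.
have tz z : (exists2 p : N, 0 < tent (val p) z &
             forall q : N, q != p -> tent (val q) z = 0) \/
            (forall q : N, tent (val q) z = 0).
  have [[p pz]|nz] := pselect (exists p : N, 0 < tent (val p) z).
    by left; exists p => // q qp; apply: (tent_disjoint (Nd _ _ qp)).
  right=> q; apply/eqP; rewrite eq_le tent_ge0 andbT leNgt.
  by apply/negP => h; apply: nz; exists q.
have [[p px hp]|hx] := tz x; have [[q qy hq]|hy] := tz y.
- have [pq|pq] := eqVneq q p.
    rewrite (bigD1 p) //= big1 ?addr0 ?tent_lipschitz // => r rp.
    by rewrite hp // hq ?pq // subrr normr0.
  rewrite (bigD1 p) //= (bigD1 q) //= big1 ?addr0; last first.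
    by move=> r /andP[rp rq]; rewrite hp // hq // subrr normr0.
  rewrite (hp q) // (hq p) 1?eq_sym // subr0 sub0r normrN.
  by rewrite !ger0_norm ?tent_ge0 // tentD // Nd.
- rewrite (bigD1 p) //= big1 ?addr0 ?tent_lipschitz // => r rp.
  by rewrite hp // hy subrr normr0.
- rewrite (bigD1 q) //= big1 ?addr0 ?tent_lipschitz // => r rp.
  by rewrite hq // hx subrr normr0.
- by rewrite big1 // => r _; rewrite hx hy subrr normr0.
Qed.

(** The tent over [p] falls from 1 at [p] to 0 at any other node, so by [connect_flow] it varies by
    at least 2 over the ordered edges. By [sum_tent_le] the variations for all [p] together fit into
    the edge lengths. *)
Lemma steiner_tree_length_ge (N : {fset V}) (T : point_graph V) :
  (1 < #|` N|)%N -> {in N &, forall p q, p != q -> 2 <= `|p - q|} ->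
  steiner_tree N T -> #|` N|%:R <= tree_length T.
Proof.
move=> N2 Nd [NT [_ sT _ cT _]].
rewrite /tree_length ler_pdivlMl //.
apply: (@le_trans _ _ (\sum_x \sum_(y | adj x y)
    \sum_(p : N) `|tent (val p) (val x) - tent (val p) (val y)|)); last first.
  by apply: ler_sum => x _; apply: ler_sum => y _; exact: sum_tent_le.
under eq_bigr do rewrite exchange_big; rewrite exchange_big /=.
have -> : 2%:R * #|` N|%:R = \sum_(p : N) 2%:R :> R.
  by rewrite sumr_const cardfE mulr_natr.
apply: ler_sum => p _.
have [q qN qp] : exists2 q, q \in N & q != val p.
  apply: contrapT => h; move: N2; rewrite ltnNge => /negP; apply.
  rewrite -(cardfs1 (val p)); apply: fsubset_leq_card; apply/fsubsetP => q qN.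
  by rewrite inE; apply: contrapT => /negP qp; apply: h; exists q.
pose a : vertices T := [` fsubsetP NT _ (valP p)]%fset.
pose b : vertices T := [` fsubsetP NT _ qN]%fset.
have := connect_flow (fun x : vertices T => tent (val p) (val x)) sT (cT a b).
apply: le_trans; rewrite ler_peMr //.
have -> : tent (val p) (val b) = 0.
  apply/max_idPl; have := Nd q (val p) qN (valP p) qp; rewrite /=; lra.
by rewrite subr0 /tent /= subrr normr0 subr0 le_max lexx orbT.
Qed.
End Packing.

(** * Steiner minimal trees *)

Definition edges (V : choiceType) (T : point_graph V) : seq (V * V) :=
  [seq (val xy.1, val xy.2) | xy <- enum [pred xy | @adj V T xy.1 xy.2]].

Lemma edges_uniq (V : choiceType) (T : point_graph V) : uniq (edges T).
Proof.
rewrite map_inj_uniq ?enum_uniq // => -[a b] [c d] [/val_inj -> /val_inj ->].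
by [].
Qed.

Lemma edgesP (V : choiceType) (T : point_graph V) (e : V * V) :
  reflect (exists x y : vertices T, adj x y /\ e = (val x, val y))
          (e \in edges T).
Proof.
apply: (iffP mapP) => [[[x y]]|[x [y [xy ->]]]].
  by rewrite mem_enum => xy ->; exists x, y.
by exists (x, y); rewrite ?mem_enum.
Qed.

Lemma tree_length_edges (R : realType) (V : normedModType R)
    (T : point_graph V) :
  2 * tree_length T = \sum_(e <- edges T) `|e.1 - e.2|.
Proof.
rewrite /tree_length mulrA mulfV ?mul1r ?pnatr_eq0 // pair_big_dep /=.
by rewrite big_map big_enum.
Qed.

(** A spanning tree of the graph given by [E] competes with [T]. Repetitions, loops and pairs
    outside [W] in the list [E] only enlarge the right-hand side. *)
Lemma smt_length_le (R : realType) (V : normedModType R) (N W : {fset V})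
    (T : point_graph V) (E : seq (V * V)) :
  steiner_minimal_tree N T -> (N `<=` W)%fset -> (0 < #|{: W}|)%N ->
  (forall a b, (a, b) \in E -> (b, a) \in E) ->
  (forall x y : W, connect (fun a b : W => (val a, val b) \in E) x y) ->
  2 * tree_length T <= \sum_(e <- E) `|e.1 - e.2|.
Proof.
move=> [_ minT] NW W0 symE cE.
have sE : symmetric (fun a b : W => (val a, val b) \in E).
  by move=> a b; apply/idP/idP => /symE.
have [e' subE te'] := spanning_tree W0 sE cE.
apply: (@le_trans _ _ (2 * tree_length (PointGraph e'))).
  by rewrite ler_pM2l // minT.
rewrite tree_length_edges; apply: ler_sum_sub => //; first exact: edges_uniq.
by move=> _ /edgesP[x [y [exy ->]]]; exact: subE.
Qed.

(* The segments [v w1], [v w2], [v w3] are exchanged for the tree with Steiner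
   points [p] and [q]; these may be vertices already. *)
Lemma smt_exchange (R : realType) (V : normedModType R) (N : {fset V})
    (T : point_graph V) (v w1 w2 w3 : vertices T) (p q : V) :
  steiner_minimal_tree N T -> uniq [:: w1; w2; w3] ->
  adj v w1 -> adj v w2 -> adj v w3 ->
  `|val w1 - val v| + `|val w2 - val v| + `|val w3 - val v| <=
  `|p - val v| + `|p - q| + `|val w2 - p| + (`|val w1 - q| + `|val w3 - q|).
Proof.
move=> smtT uw a1 a2 a3; have [[NT [_ symT irrT cT _]] _] := smtT.
pose swap (e : V * V) := (e.2, e.1).
pose F := [:: (val v, val w1); (val v, val w2); (val v, val w3)].
pose G := [:: (p, val v); (p, q); (val w2, p); (val w1, q); (val w3, q)].
pose sF := F ++ map swap F; pose sG := G ++ map swap G.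
have symcat (H : seq (V * V)) a b :
    (a, b) \in H ++ map swap H -> (b, a) \in H ++ map swap H.
  rewrite !mem_cat => /orP[ab|/mapP[[c d] cd [-> ->]]]; last by rewrite cd.
  by apply/orP; right; apply/mapP; exists (a, b).
have sumcat (H : seq (V * V)) : \sum_(e <- H ++ map swap H) `|e.1 - e.2| =
    2 * \sum_(e <- H) `|e.1 - e.2|.
  rewrite big_cat big_map /= [X in _ + X](eq_bigr (fun e => `|e.1 - e.2|)).
    by rewrite mulrDl mul1r.
  by move=> e _; rewrite distrC.
have vw w : adj v w -> (val v == val w) = false.
  move=> vw; rewrite (inj_eq val_inj).
  by apply/negP => /eqP vw'; move: vw; rewrite vw' irrT.
(* The removed pairs must be distinct, for each is counted only once in [edges T]. *)
have uF : uniq sF.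
  move: uw; rewrite /= !inE !xpair_eqE !(inj_eq val_inj) !eqxx /= !andbT.
  have e1 := vw _ a1; have e2 := vw _ a2; have e3 := vw _ a3.
  rewrite !(inj_eq val_inj) in e1 e2 e3.
  rewrite ?e1 ?e2 ?e3 ![_ == v]eq_sym ?e1 ?e2 ?e3 /= ?andbF ?orbF.
  by rewrite !negb_or => /andP[-> ->].
have FE : {subset sF <= edges T}.
  have FE e : e \in F -> e \in edges T /\ swap e \in edges T.
    by rewrite !inE => /or3P[] /eqP ->; split; apply/edgesP;
      do 2 eexists; split; try reflexivity; rewrite // symT.
  by move=> e; rewrite mem_cat => /orP[/FE[]//|/mapP[f /FE[_ h] ->]].
have ET : perm_eq (edges T) (sF ++ [seq e <- edges T | e \notin sF]).
  apply: uniq_perm => [||e]; first exact: edges_uniq.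
    rewrite cat_uniq uF filter_uniq ?edges_uniq // andbT.
    by apply/hasPn => e; rewrite mem_filter => /andP[].
  by rewrite mem_cat mem_filter; case: (boolP (e \in sF)) => //= /FE ->.
pose E' := [seq e <- edges T | e \notin sF] ++ sG.
pose W := (vertices T `|` [fset p; q])%fset.
have TW : (vertices T `<=` W)%fset by exact: fsubsetUl.
have pW : p \in W by rewrite !inE eqxx orbT.
have qW : q \in W by rewrite !inE eqxx !orbT.
have symE' a b : (a, b) \in E' -> (b, a) \in E'.
  rewrite /E' 2!(mem_cat _ [seq _ <- _ | _]) !mem_filter.
  case/orP=> [/andP[nF /edgesP[x [y [exy [ea eb]]]]]|/symcat ->]; last first.
    by rewrite orbT.
  apply/orP; left; apply/andP; split; first by apply: contra nF => /symcat.
  by apply/edgesP; exists y, x; rewrite symT ea eb.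
pose r (a b : W) := (val a, val b) \in E'.
have symr : symmetric r by move=> a b; apply/idP/idP => /symE'.
have csym := sym_connect_sym symr.
pose i x : W := fincl TW x.
have rG (a b : W) : (val a, val b) \in sG -> connect r a b.
  by move=> h; apply: connect1; rewrite /r mem_cat h orbT.
pose P : W := [` pW]%fset; pose Q : W := [` qW]%fset.
have Pv : connect r P (i v) by apply: rG; rewrite !inE eqxx.
have Qv : connect r Q (i v).
  apply: connect_trans Pv; rewrite csym; apply: rG.
  by rewrite !inE eqxx ?orbT.
have wv w : w \in [:: w1; w2; w3] -> connect r (i w) (i v).
  rewrite !inE => /or3P[] /eqP ->.
  - by apply: connect_trans Qv; apply: rG; rewrite !inE eqxx ?orbT.
  - by apply: connect_trans Pv; apply: rG; rewrite !inE eqxx ?orbT.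
  - by apply: connect_trans Qv; apply: rG; rewrite !inE eqxx ?orbT.
have Fv x y : (val x, val y) \in F -> connect r (i x) (i y).
  rewrite !inE !xpair_eqE !(inj_eq val_inj) -!andb_orr => /andP[/eqP -> yw].
  by rewrite csym wv // !inE.
(* An old edge either survives in [E'] or belongs to [sF], and then its ends are joined through
   [G]. *)
have Ti x y : adj x y -> connect r (i x) (i y).
  move=> axy; have [xyF|xyF] := boolP ((val x, val y) \in sF).
    move: xyF; rewrite mem_cat => /orP[/Fv//|/mapP[[a b] abF [xb ya]]].
    by rewrite csym; apply: Fv; move: abF; rewrite -[a]ya -[b]xb.
  apply: connect1; rewrite /r mem_cat mem_filter xyF /=.
  by apply/orP; left; apply/edgesP; exists x, y.
have Tv x : connect r (i x) (i v).
  have /connectP[s + ->] := cT x v.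
  elim: s x => [|y s IH] x /=; first by rewrite connect0.
  by move=> /andP[/Ti xy /IH]; exact: connect_trans.
have Wv (x : W) : connect r x (i v).
  have := valP x; rewrite !inE => /orP[xT|/orP[/eqP xp|/eqP xq]].
  - by have -> : x = i [` xT]%fset by apply: val_inj.
  - by have -> : x = P by apply: val_inj.
  - by have -> : x = Q by apply: val_inj.
have := @smt_length_le _ _ N W T E' smtT (fsubset_trans NT TW).
have W0 : (0 < #|{: W}|)%N by apply/card_gt0P; exists P.
move=> /(_ W0 symE') h.
have {}h := h (fun x y => connect_trans (Wv x) (etrans (csym _ _) (Wv y))).
rewrite tree_length_edges (perm_big _ ET) [leLHS]big_cat [leRHS]big_cat in h.
rewrite (sumcat F) (sumcat G) [leLHS]addrC lerD2l ler_pM2l // in h.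
move: h; rewrite !big_cons !big_nil /= !addr0 !addrA !(distrC (val v)).
by [].
Qed.

(** * The norm of MZ *)

Section Geometry.
Context {R : realType} {n : nat}.
Implicit Types (x : MZ R n) (g h : 'I_n.+1 -> R) (S : {set 'I_n.+1}).

(* [MZ R n] is R^(n+1) modulo constants with the norm max - min:
   [ext] picks the representative with zeroth coordinate 0, and [pr] is the
   quotient map. *)
Definition ext x (a : 'I_n.+1) : R :=
  if unlift ord0 a is Some i then (x : 'rV[R]_n) ord0 i else 0.

Definition pr g : MZ R n := \row_i (g (lift ord0 i) - g ord0).

Lemma ext_pr g a : ext (pr g) a = g a - g ord0.
Proof.
rewrite /ext; case: unliftP => [i ->|->]; first by rewrite mxE.
by rewrite subrr.
Qed.

Lemma ext_lift x i : ext x (lift ord0 i) = (x : 'rV[R]_n) ord0 i.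
Proof. by rewrite /ext liftK. Qed.

Lemma ext0 x : ext x ord0 = 0.
Proof. by rewrite /ext unlift_none. Qed.

Lemma pr_ext x : pr (ext x) = x.
Proof. by apply/rowP => i; rewrite mxE ext_lift ext0 subr0. Qed.

Lemma prB g h : pr g - pr h = pr (fun a => g a - h a).
Proof. by apply/rowP => i; rewrite !mxE; ring. Qed.

Lemma prZ t g : t *: pr g = pr (fun a => t * g a).
Proof. by apply/rowP => i; rewrite !mxE; ring. Qed.

Lemma norm_MZE x : `|x| = hi x + hi (- x).
Proof. exact: gauge_ZballE. Qed.

(** The two parts of the norm measure how far [g] rises above and falls below [g ord0]. Together
    with [norm_pr_ge] this gives max - min. *)
Lemma norm_pr_le g lo up : (forall a, lo <= g a <= up) -> `|pr g| <= up - lo.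
Proof.
move=> bg; rewrite norm_MZE.
have -> : up - lo = (up - g ord0) + (g ord0 - lo) by ring.
have /andP[lo0 up0] := bg ord0.
apply: lerD; apply: hi_le => [|i]; rewrite ?subr_ge0 //;
  by have /andP[l u] := bg (lift ord0 i); rewrite !mxE; lra.
Qed.

Lemma norm_pr_ge g a b : g a - g b <= `|pr g|.
Proof.
rewrite norm_MZE.
have -> : g a - g b = ext (pr g) a + (- ext (pr g) b) by rewrite !ext_pr; ring.
apply: lerD; rewrite /ext; case: unliftP => [i _|_];
  rewrite ?oppr0 ?hi_ge0 ?le_hi //.
by have := le_hi (- pr g) i; rewrite [X in X <= _]mxE.
Qed.

Definition ind S (a : 'I_n.+1) : R := (a \in S)%:R.

Lemma norm_ind_le S : `|pr (ind S)| <= 1.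
Proof.
rewrite -[leRHS]subr0; apply: norm_pr_le => a.
by rewrite /ind; case: (a \in S); rewrite ?lexx ?ler01.
Qed.

(** Neither of two distinct sets of equal size contains the other, so the difference of their
    indicators takes both values 1 and -1. *)
Lemma norm_indB_ge S S' : #|S| = #|S'| -> S != S' ->
  2 <= `|pr (ind S) - pr (ind S')|.
Proof.
move=> eS nS.
have ex (A B : {set 'I_n.+1}) : #|A| = #|B| -> A != B ->
    exists2 a, a \in A & a \notin B.
  move=> AB nAB; apply/fintype.subsetPn; apply: contra nAB => sAB.
  by rewrite eqEcard sAB AB leqnn.
have [a aS aS'] := ex _ _ eS nS.
have [b bS' bS] := ex _ _ (esym eS) (contra_neq esym nS).
have := norm_pr_ge (fun a => ind S a - ind S' a) a b.
rewrite prB /ind aS bS' (negPf aS') (negPf bS) /=; apply: le_trans; lra.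
Qed.

(** * The exchange argument near a vertex *)

Definition top x : {set 'I_n.+1} :=
  [set a | [forall b, ext x b <= ext x a]]%SET.

(** Subtracting [t * g] lowers the maximum by at least [t * a] and the minimum by at most [t * b]:
    coordinates off [top x] fall by at most [t * b], and those on [top x] start at least [d] above
    the minimum. *)
Lemma top_gain x : x != 0 -> exists2 d, 0 < d &
  forall g a b t, 0 < t <= d -> 0 <= b -> a <= 1 ->
    (forall i, 0 <= g i <= 1) ->
    {in top x, forall i, a <= g i} ->
    (forall i, i \notin top x -> g i <= b) ->
    `|x - t *: pr g| <= `|x| - t * (a - b).
Proof.
move=> x0.
have [iM _ maxM] := @arg_maxP _ _ _ ord0 xpredT (ext x) isT.
have [im _ minm] := @arg_minP _ _ _ ord0 xpredT (ext x) isT.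
set M := ext x iM in maxM; set m := ext x im in minm.
have {}maxM i : ext x i <= M by exact: maxM.
have {}minm i : m <= ext x i by exact: minm.
have topM i : i \in top x -> ext x i = M.
  rewrite inE => /forallP/(_ iM) h; apply/eqP.
  by rewrite eq_le h andbT maxM.
have topN i : i \notin top x -> 0 < M - ext x i.
  rewrite subr_gt0 ltNge; apply: contra => Mi; rewrite inE.
  by apply/forallP => j; apply: le_trans Mi; exact: maxM.
have Mm : M - m <= `|x| by rewrite -{1}(pr_ext x) norm_pr_ge.
(* A coordinate both minimal and maximal would make all coordinates equal, hence [x = 0]. *)
have imN : im \notin top x.
  apply: contra x0 => /topM imM; rewrite -normr_le0 -{1}(pr_ext x).
  rewrite -[leRHS](subrr m); apply: norm_pr_le => i.
  by rewrite minm /m imM maxM.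
(* The gap below the maximum, capped at 1: for [t <= d] no coordinate off [top x] exceeds the
   lowered maximum. *)
pose d := \big[Num.min/1]_(i | i \notin top x) (M - ext x i).
have d0 : 0 < d by apply: lt_bigmin => // i; exact: topN.
have dle i : i \notin top x -> d <= M - ext x i by move=> h; exact: bigmin_le_cond.
exists d => // g a b t /andP[t0 td] b0 a1 g01 ga gb.
rewrite -{1}(pr_ext x) prZ prB.
apply: (@le_trans _ _ ((M - t * a) - (m - t * b))); last by lra.
have dm := dle _ imN; rewrite -/m in dm.
have tb : 0 <= t * b by rewrite mulr_ge0 // ltW.
have ta : t * a <= t by rewrite ler_piMr // ltW.
apply: norm_pr_le => i; have /andP[gi0 gi1] := g01 i.
have tg0 : 0 <= t * g i by rewrite mulr_ge0 // ltW.
have tg1 : t * g i <= t by rewrite ler_piMr // ltW.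
have [iS|iS] := boolP (i \in top x).
  rewrite (topM _ iS); have : t * a <= t * g i by rewrite ler_pM2l // ga.
  by move=> h; apply/andP; split; lra.
have : t * g i <= t * b by rewrite ler_pM2l // gb.
have := dle _ iS; have := minm i.
by move=> h1 h2 h3; apply/andP; split; lra.
Qed.

(** [gp] and [gq] are the directions of the two new Steiner points. Nestedness keeps [gp - gq] in an
    interval of length 1/2, so these points are close to each other. *)
Lemma ind_chain S1 S2 S3 a : S1 \subset S2 -> S2 \subset S3 ->
  let gp := 2^-1 * ind S2 a in let gq := 2^-1 * (ind S1 a + ind S3 a) in
  [/\ 0 <= gp <= 1, 0 <= gq <= 1 & - 2^-1 <= gp - gq <= 0] /\
  [/\ a \in S1 -> 1 <= gq, a \notin S1 -> gq <= 2^-1,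
      a \in S3 -> 2^-1 <= gq & a \notin S3 -> gq <= 0].
Proof.
move=> /fintype.subsetP/(_ a) + /fintype.subsetP/(_ a); rewrite /ind.
case: (a \in S1); case: (a \in S2); case: (a \in S3) => h1 h2;
  try (by have := h1 isT); try (by have := h2 isT);
  by do !split=> //=; try (apply/andP; split); lra.
Qed.

(** Each of the three edges to the [w]'s shortens by at least t/2, while the new edges [p v] and
    [p q] cost at most t/2 each: a net saving of at least t/2. *)
Lemma smt_chain_free (N : {fset MZ R n}) (T : point_graph (MZ R n))
    (v : vertices T) :
  steiner_minimal_tree N T ->
  chain_free (fun w : vertices T => top (val w - val v))
    [set w | adj v w]%SET 2.
Proof.
(* Chains decrease, so [w3], with the largest set, comes first. *)
move=> smtT [|w3 [|w2 [|w1 s]]] //= us sD /and3P[S23 S12 _]; exfalso.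
have half1 : 2^-1 <= 1 :> R by lra.
have arith (t x1 x2 x3 y1 y2 y3 u1 u2 : R) : 0 < t ->
    y1 <= x1 - t * (1 - 2^-1) -> y2 <= x2 - t * (2^-1 - 0) ->
    y3 <= x3 - t * (2^-1 - 0) -> u1 <= t * 2^-1 -> u2 <= t * 2^-1 ->
    x1 + x2 + x3 <= u1 + u2 + y2 + (y1 + y3) -> False by lra.
have [[_ [_ _ irrT _ _]] _] := smtT.
have adjw w : w \in [:: w1; w2; w3] -> adj v w.
  move=> ws; have := sD w; rewrite [w \in finset _]inE; apply.
  by move: ws; rewrite !inE => /or3P[] ->; rewrite ?orbT.
have nzw w : w \in [:: w1; w2; w3] -> val w - val v != 0.
  move=> /adjw vw; rewrite subr_eq0 (inj_eq val_inj).
  by apply: contraTneq vw => ->; rewrite irrT.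
have uw : uniq [:: w1; w2; w3].
  move: us; rewrite !inE !negb_or /=.
  case/and3P=> /and3P[h1 h2 _] /andP[h3 _] _.
  by rewrite !inE negb_or eq_sym h3 (eq_sym w1) h2 eq_sym h1.
have [d1 d10 g1] := top_gain (nzw w1 (ltac:(by rewrite !inE eqxx))).
have [d2 d20 g2] := top_gain (nzw w2 (ltac:(by rewrite !inE eqxx orbT))).
have [d3 d30 g3] := top_gain (nzw w3 (ltac:(by rewrite !inE eqxx !orbT))).
pose t := Num.min d1 (Num.min d2 d3).
have t0 : 0 < t by rewrite !lt_min d10 d20.
have td1 : 0 < t <= d1 by rewrite t0 !ge_min lexx.
have td2 : 0 < t <= d2 by rewrite t0 !ge_min lexx !orbT.
have td3 : 0 < t <= d3 by rewrite t0 !ge_min lexx !orbT.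
set S1 := top (val w1 - val v) in g1 S12.
set S2 := top (val w2 - val v) in g2 S12 S23.
set S3 := top (val w3 - val v) in g3 S23.
have S123 a := ind_chain a S12 S23.
pose gp a : R := 2^-1 * ind S2 a.
pose gq a : R := 2^-1 * (ind S1 a + ind S3 a).
pose p : MZ R n := val v + t *: pr gp; pose q : MZ R n := val v + t *: pr gq.
have := smt_exchange p q smtT uw (adjw w1 _) (adjw w2 _) (adjw w3 _).
rewrite !inE !eqxx !orbT => /(_ isT isT isT).
have dE (w : MZ R n) g : `|w - (val v + t *: pr g)| = `|(w - val v) - t *: pr g|.
  by rewrite opprD addrA.
have E2 : `|val w2 - p| <= `|val w2 - val v| - t * (2^-1 - 0).
  rewrite dE; apply: g2 => // i => [|iS|iS].
  - by have [[]] := S123 i.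
  - by rewrite /gp /ind iS mulr1.
  - by rewrite /gp /ind (negPf iS) mulr0.
have E1 : `|val w1 - q| <= `|val w1 - val v| - t * (1 - 2^-1).
  by rewrite dE; apply: g1 => // i; have [[? ? ?] []] := S123 i.
have E3 : `|val w3 - q| <= `|val w3 - val v| - t * (2^-1 - 0).
  by rewrite dE; apply: g3 => // i; have [[? ? ?] []] := S123 i => //.
have Ep : `|p - val v| <= t * 2^-1.
  rewrite /p addrC addKr prZ -[leRHS]subr0; apply: norm_pr_le => a.
  have [[/andP[h _] _ _] _] := S123 a; rewrite mulr_ge0 ?(ltW t0) //=.
  by rewrite ler_pM2l // /gp ler_piMr // /ind lern1 leq_b1.
have Epq : `|p - q| <= t * 2^-1.
  rewrite /p /q opprD addrACA subrr add0r -scalerBr prB prZ.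
  have -> : t * 2^-1 = t * 0 - t * - 2^-1 by ring.
  apply: norm_pr_le => a; have [[_ _ /andP[h1 h2]] _] := S123 a.
  by rewrite !ler_pM2l // h1 h2.
by move=> h; exact: arith t0 E1 E2 E3 Ep Epq h.
Qed.

(** * Upper and lower bounds for the degrees of Steiner points *)

Lemma steiner_degree_le (d : nat) : steiner_point_degrees (MZ R n) d ->
  (d <= 2 * 'C(n.+1, n.+1./2))%N.
Proof.
case=> N [T [v [smtT _ <-]]].
have := card_chain_free (smt_chain_free (v := v) smtT).
by rewrite card_ord.
Qed.

(** The star joining 0 to the indicators of all [k]-sets has edges of length at most 1, so it
    attains the packing bound. *)
Lemma steiner_degree_half_bin : (2 <= n)%N ->
  steiner_point_degrees (MZ R n) 'C(n.+1, n.+1./2).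
Proof.
move=> n2; set k := n.+1./2.
pose F := [set S : {set 'I_n.+1} | #|S| == k]%SET.
pose N := [fset pr (ind S) | S in F]%fset.
have Nd : {in N &, forall p q, p != q -> 2 <= `|p - q|}.
  move=> _ _ /imfsetP[/= S + ->] /imfsetP[/= S' + ->].
  rewrite !inE => /eqP cS /eqP cS' nS; apply: norm_indB_ge; rewrite ?cS //.
  by apply: contraNneq nS => ->.
have cardN : #|` N| = 'C(n.+1, k).
  rewrite card_in_imfset /=; last first.
    move=> S S'; rewrite !inE => /eqP cS /eqP cS' eS; apply: contrapT => /eqP nS.
    have := norm_indB_ge (etrans cS (esym cS')) nS.
    by rewrite eS subrr normr0; lra.
  by rewrite -cardE card_draws card_ord.
have N2 : (1 < #|` N|)%N.
  rewrite cardN; apply: (@leq_trans 'C(n.+1, 1)); first by rewrite bin1 ltnS ltnW.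
  exact: leq_bin_half.
(* The centre is a genuine Steiner point: [k] lies strictly between 0 and n+1, so no indicator of a
   [k]-set is constant. *)
have N0 : 0 \notin N.
  apply/imfsetP => -[/= S]; rewrite inE => /eqP cS S0.
  have [a aS] : exists a, a \in S by apply/card_gt0P; rewrite cS /k; lia.
  have [b bS] : exists b, b \notin S.
    have : (0 < #|~: S|)%N by rewrite cardsCs finset.setCK card_ord cS /k; lia.
    by move=> /card_gt0P[b]; rewrite inE; exists b.
  have := norm_pr_ge (ind S) a b; rewrite -S0 normr0 /ind aS (negPf bS) /=; lra.
pose W := (0 |` N)%fset.
have W0 : 0 \in W by rewrite fset1U1.
pose c : W := [` W0]%fset.
have cardW : #|{: W}|.-1 = 'C(n.+1, k) by rewrite -cardfE cardfsU1 N0 cardN.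
pose T := @PointGraph (MZ R n) W (fun x y : W => (x == c) (+) (y == c)).
have NT : steiner_tree N T.
  by split; [exact: fsubsetU1 | exact: star_is_tree].
exists N, T, c; split=> //; last first.
  rewrite /degree -cardW -(cardsC1 c); apply: eq_card => w.
  by rewrite !inE /= eqxx.
split=> // T' NT'; apply: le_trans (steiner_tree_length_ge N2 Nd NT').
have nW (w : W) : w != c -> `|val w| <= 1.
  move=> wc; have := valP w; rewrite !inE => /orP[/eqP w0|].
    by case/eqP: wc; apply: val_inj.
  by case/imfsetP => /= S _ ->; exact: norm_ind_le.
(* The ordered pairs split into those leaving [c] and those entering it; each half contributes at
   most 1 per node. *)
rewrite /tree_length ler_pdivrMl // (bigD1 c) //= mulrDl mul1r.
have cardc : (#|` N|%:R : R) = \sum_(w : W | w != c) 1.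
  rewrite sumr_const cardN -cardW -(cardsC1 c) -cardsE.
  by congr (_ %:R); apply: eq_card => w; rewrite !inE.
apply: lerD; rewrite {1}cardc.
  rewrite (eq_bigl (fun w : W => w != c)); last by move=> w; rewrite eqxx.
  by apply: ler_sum => w wc; rewrite sub0r normrN nW.
apply: ler_sum => w wc; rewrite (big_pred1 c); last first.
  by move=> y; rewrite (negPf wc).
by rewrite subr0 nW.
Qed.

End Geometry.

(** The occurring degrees form a nonempty bounded set of naturals, so [xget] returns their maximum
    and not the default 0. *)
Lemma max_steiner_degree_bounds (R : realType) (n : nat) : (2 <= n)%N ->
  ('C(n.+1, n.+1./2) <= max_steiner_degree (MZ R n)
     <= 2 * 'C(n.+1, n.+1./2))%N.
Proof.
move=> n2; have dC := @steiner_degree_half_bin R n n2.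
pose D d := `[< steiner_point_degrees (MZ R n) d >].
have exD : exists d, D d by exists 'C(n.+1, n.+1./2); apply/asboolP.
have ubD d : D d -> (d <= 2 * 'C(n.+1, n.+1./2))%N.
  by move=> /asboolP; exact: steiner_degree_le.
have [m /asboolP Dm maxm] := ex_maxnP exD ubD.
rewrite /max_steiner_degree; case: xgetP => [d _ [Dd maxd]|/(_ m) []].
  by rewrite maxd // (steiner_degree_le Dd).
by split=> // d /asboolP; exact: maxm.
Qed.

Theorem theorem6 (R : realType) :
  (forall n : nat, (3 <= n)%N ->
     ('C(n.+1, n.+1./2) <= max_steiner_degree (MZ R n))%N)
  /\
  (fun n : nat => (max_steiner_degree (MZ R n))%:R : R^o) =Theta_\oo
  (fun n : nat => 2 ^+ n / Num.sqrt (n%:R) : R^o).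
Proof.
split=> [n n3|]; first by have /andP[] := max_steiner_degree_bounds R (ltnW n3).
(* The constant 1/2 is that of [half_bin_asymp]; 4 is its upper constant 2 times the factor 2 of the
   degree bound. *)
rewrite eqThetaE qualifE; apply/asboolP; exists (2^-1, 4) => /=.
  by rewrite invr_gt0 !ltr0n.
near=> n; have n2 : (2 <= n)%N by near: n; exact: nbhs_infty_ge.
have /andP[lo up] := max_steiner_degree_bounds R n2.
have /andP[lo' up'] := half_bin_asymp R (ltnW n2).
rewrite -(ler_nat R) in lo; rewrite -(ler_nat R) natrM in up.
rewrite !ger0_norm ?divr_ge0 ?sqrtr_ge0 ?exprn_ge0 //.
by split; lra.
Unshelve. all: by end_near.
Qed.
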